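(* Let $s,y>0$ and consider $N(1,1)=\mathrm{SU}(3)/S^1$ with the metric $g_{s,y}$. Among the algebraic $3$-forms $$\mathrm{T}=\alpha X_{135}+\beta X_{146}+\gamma X_{245}+\delta X_{236}+\mu X_{127}+\nu X_{347}+\eta X_{567}$$ on $\mathfrak{m}$ ($\alpha,\dots,\eta\in\mathbb{R}$), the spinor field $\psi_4$ satisfies the equation $\nabla^g_X\psi_4+(X\lrcorner\,\mathrm{T})\cdot\psi_4=0$ (for all $X$) exactly for one $3$-form $\mathrm{T}=\mathrm{T}_4$, namely $$\mathrm{T}_4=\Big[\tfrac12-\tfrac y4-\tfrac{1+y}{6s}+\tfrac s3\Big][X_{135}+X_{146}]+\Big[\tfrac12-\tfrac y4+\tfrac{1+y}{6s}-\tfrac s3\Big][X_{245}-X_{236}]+\Big[\tfrac{2y-1}{6s}-\tfrac{2s}{3}\Big]X_{127}+\Big[\tfrac{4+y}{12s}-\tfrac{2s}{3}\Big][X_{347}-X_{567}].$$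
   Context: $S^1\subset\mathrm{SU}(3)$ is embedded by $e^{i\theta}\mapsto\mathrm{diag}(e^{i\theta},e^{i\theta},e^{-2i\theta})$. Let $E_{ij}$ ($i<j$) be the matrix with $1$ at place $(i,j)$ and zero elsewhere, $A_{ij}=E_{ij}-E_{ij}^t$, $\tilde A_{ij}=i(E_{ij}+E_{ij}^t)$, $L=\mathrm{diag}(3i,-3i,0)$; $\mathfrak{m}_0=\mathrm{Lin}\{L\}$, $\mathfrak{m}_1=\mathrm{Lin}\{A_{12},\tilde A_{12}\}$, $\mathfrak{m}_2=\mathrm{Lin}\{A_{13},\tilde A_{13}\}$, $\mathfrak{m}_3=\mathrm{Lin}\{A_{23},\tilde A_{23}\}$. Then $\mathfrak{su}(3)=\mathfrak{m}\oplus\mathbb{R}$ with $\mathfrak{m}=\mathfrak{m}_0\oplus\mathfrak{m}_1\oplus\mathfrak{m}_2\oplus\mathfrak{m}_3$. With $B(X,Y)=-\frac12\mathrm{Re}\,\mathrm{tr}(XY)$, the $\mathrm{SU}(3)$-invariant metric is $g=g_{s,y}=\frac1{s^2}B|_{\mathfrak{m}_0}+B|_{\mathfrak{m}_1}+\frac1yB|_{\mathfrak{m}_2}+\frac1yB|_{\mathfrak{m}_3}$. An orthonormal basis of $\mathfrak{m}$ is $X_1=A_{12}$, $X_2=\tilde A_{12}$, $X_3=\sqrt yA_{13}$, $X_4=\sqrt y\tilde A_{13}$, $X_5=\sqrt yA_{23}$, $X_6=\sqrt y\tilde A_{23}$, $X_7=sL/3$; $X_{ijk}:=X_i\wedge X_j\wedge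 X_k$. $\lrcorner$ is the interior product. Spinors: $\Delta_7=\mathbb{R}^8$ with basis $\psi_1,\dots,\psi_8$. Let $F_{ij}$ be the skew endomorphism $\psi_i\mapsto\psi_j$, $\psi_j\mapsto-\psi_i$, other $\psi_k\mapsto0$. Clifford multiplication by $X_i$ is $e_i$, where $e_1=F_{18}+F_{27}-F_{36}-F_{45}$, $e_2=-F_{17}+F_{28}+F_{35}-F_{46}$, $e_3=-F_{16}+F_{25}-F_{38}+F_{47}$, $e_4=-F_{15}-F_{26}-F_{37}-F_{48}$, $e_5=-F_{13}-F_{24}+F_{57}+F_{68}$, $e_6=F_{14}-F_{23}-F_{58}+F_{67}$, $e_7=F_{12}-F_{34}-F_{56}+F_{78}$; $X_i\wedge X_j$ ($i\ne j$) acts as $e_i e_j$. The spinors $\psi_3,\psi_4,\psi_5,\psi_6$ are fixed by the lifted isotropy representation and define constant sections of the spinor bundle $S=\mathrm{SU}(3)\times_{\widetilde{\mathrm{Ad}}}\Delta_7$. For such a constant section $\psi$, $\nabla^g_{X}\psi=\tilde\Lambda(X)\psi$, where the lift $\tilde\Lambda:\mathfrak{m}\to\mathfrak{spin}(7)$ of the Levi-Civita connection is $\tilde\Lambda(X_1)=\frac1{2s}e_2e_7-[\frac12-\frac y4](e_3e_5+e_4e_6)$, $\tilde\Lambda(X_2)=-\frac1{2s}e_1e_7-[\frac12-\frac y4](e_4e_5-e_3e_6)$, $\tilde\Lambda(X_3)=\frac y{4s}e_4e_7-\frac y4(e_2e_6-e_1e_5)$, $\tilde\Lambda(X_4)=-\frac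 y{4s}e_3e_7+\frac y4(e_1e_6+e_2e_5)$, $\tilde\Lambda(X_5)=-\frac y{4s}e_6e_7-\frac y4(e_1e_3+e_2e_4)$, $\tilde\Lambda(X_6)=\frac y{4s}e_5e_7-\frac y4(e_1e_4-e_2e_3)$, $\tilde\Lambda(X_7)=\frac s2(2e_1e_2+e_3e_4-e_5e_6)-\frac1{2s}e_1e_2-\frac y{4s}e_3e_4+\frac y{4s}e_5e_6$. *)

(* Defs.v *)
From HB Require Import structures.
From mathcomp Require Import all_boot all_order all_algebra.
From mathcomp Require Import reals.
From mathcomp.real_closed Require Import complex.
From mathcomp Require Import ring lra.

Set Implicit Arguments.
Unset Strict Implicit.
Unset Printing Implicit Defensive.

Import Order.TTheory GRing.Theory Num.Theory.

Local Open Scope ring_scope.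
Local Open Scope complex_scope.

Section Geometry.
Variable R : realType.

(* Matrix places, basis vectors and spinors are numbered from 1. *)
Definition Emx (i j : nat) : 'M[R[i]]_3 :=
  \matrix_(a, b) ((a.+1 == i) && (b.+1 == j))%:R.

Definition Amx (i j : nat) : 'M[R[i]]_3 := Emx i j - (Emx i j)^T.

Definition Atmx (i j : nat) : 'M[R[i]]_3 := 'i *: (Emx i j + (Emx i j)^T).

Definition Lmx : 'M[R[i]]_3 := diag_mx (\row_j [:: 3 * 'i; - (3 * 'i); 0]`_j).

(* Generator of the Lie algebra of the circle. *)
Definition Hmx : 'M[R[i]]_3 := diag_mx (\row_j [:: 'i; 'i; - (2 * 'i)]`_j).

Definition su3 (M : 'M[R[i]]_3) : Prop :=
  map_mx (@conjc R) M^T = - M /\ \tr M = 0.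

Definition B (M N : 'M[R[i]]_3) : R := - (1 / 2) * complex.Re (\tr (M *m N)).

Definition m0 : seq 'M[R[i]]_3 := [:: Lmx].
Definition m1 : seq 'M[R[i]]_3 := [:: Amx 1 2; Atmx 1 2].
Definition m2 : seq 'M[R[i]]_3 := [:: Amx 1 3; Atmx 1 3].
Definition m3 : seq 'M[R[i]]_3 := [:: Amx 2 3; Atmx 2 3].

(* B-orthogonal projection onto the real span of a B-orthogonal family. *)
Definition proj (V : seq 'M[R[i]]_3) (M : 'M[R[i]]_3) : 'M[R[i]]_3 :=
  \sum_(N <- V) (B N M / B N N)%:C *: N.

(* The line spanned by Hmx is the B-orthogonal complement of m in su(3), so
   this is the projection of su(3) = m + R onto m (see su3_decomposition). *)
Definition proj_m : 'M[R[i]]_3 -> 'M[R[i]]_3 := proj (m0 ++ m1 ++ m2 ++ m3).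

Definition g (s y : R) (M N : 'M[R[i]]_3) : R :=
  1 / s ^+ 2 * B (proj m0 M) (proj m0 N) + B (proj m1 M) (proj m1 N)
  + 1 / y * B (proj m2 M) (proj m2 N) + 1 / y * B (proj m3 M) (proj m3 N).

Definition frame (s y : R) (i : nat) : 'M[R[i]]_3 :=
  match i with
  | 1 => Amx 1 2
  | 2 => Atmx 1 2
  | 3 => (Num.sqrt y)%:C *: Amx 1 3
  | 4 => (Num.sqrt y)%:C *: Atmx 1 3
  | 5 => (Num.sqrt y)%:C *: Amx 2 3
  | 6 => (Num.sqrt y)%:C *: Atmx 2 3
  | 7 => (s / 3)%:C *: Lmx
  | _ => 0
  end.

(* From here on the space m is R^7, by coordinates in the g-orthonormal basis
   X_1, ..., X_7; vec and coords translate to and from matrices. *)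
Definition vec (s y : R) (u : 'rV[R]_7) : 'M[R[i]]_3 :=
  \sum_(i < 7) (u 0 i)%:C *: frame s y i.+1.

Definition coords (s y : R) (M : 'M[R[i]]_3) : 'rV[R]_7 :=
  \row_i g s y M (frame s y i.+1).

Definition Xv (i : nat) : 'rV[R]_7 := \row_j (j.+1 == i)%:R.

Definition bracket_m (M N : 'M[R[i]]_3) : 'M[R[i]]_3 :=
  proj_m (M *m N - N *m M).

(* The Levi-Civita connection of a reductive homogeneous space as the map
   Lambda : m -> so(m),
   2 g(Lambda(X) Y, Z) = g([X,Y]_m, Z) + g([Z,X]_m, Y) + g(X, [Z,Y]_m). *)
Definition levi_civita (s y : R) (u v : 'rV[R]_7) : 'rV[R]_7 :=
  let X := vec s y u in
  let Y := vec s y v in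
  \row_k
    (let Z := frame s y k.+1 in
     1 / 2 * (g s y (bracket_m X Y) Z + g s y (bracket_m Z X) Y
              + g s y X (bracket_m Z Y))).

Definition isotropy (s y : R) (u : 'rV[R]_7) : 'rV[R]_7 :=
  let Y := vec s y u in coords s y (Hmx *m Y - Y *m Hmx).

Definition psi (k : nat) : 'cV[R]_8 := \col_a (a.+1 == k)%:R.

(* Matrices act on columns: F i j maps psi i to psi j and psi j to - psi i. *)
Definition F (i j : nat) : 'M[R]_8 :=
  \matrix_(a, b) (((a.+1 == j) && (b.+1 == i))%:R
                  - ((a.+1 == i) && (b.+1 == j))%:R).

Definition e (i : nat) : 'M[R]_8 :=
  match i with
  | 1 => F 1 8 + F 2 7 - F 3 6 - F 4 5
  | 2 => - F 1 7 + F 2 8 + F 3 5 - F 4 6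
  | 3 => - F 1 6 + F 2 5 - F 3 8 + F 4 7
  | 4 => - F 1 5 - F 2 6 - F 3 7 - F 4 8
  | 5 => - F 1 3 - F 2 4 + F 5 7 + F 6 8
  | 6 => F 1 4 - F 2 3 - F 5 8 + F 6 7
  | 7 => F 1 2 - F 3 4 - F 5 6 + F 7 8
  | _ => 0
  end.

Definition clifford (u : 'rV[R]_7) : 'M[R]_8 := \sum_(i < 7) u 0 i *: e i.+1.

(* The inverse of spin(7) -> so(7): for f skew-symmetric, spin_lift f is the
   element of spin(7) whose commutator with clifford u is clifford (f u). *)
Definition spin_lift (f : 'rV[R]_7 -> 'rV[R]_7) : 'M[R]_8 :=
  (1 / 4) *: \sum_(i < 7) e i.+1 *m clifford (f (Xv i.+1)).

Definition Lambda_lift (s y : R) (u : 'rV[R]_7) : 'M[R]_8 :=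
  spin_lift (levi_civita s y u).

(* Covariant derivative of the constant section with value phi; it is again
   constant, as the derivative of phi along SU(3) vanishes. *)
Definition nabla (s y : R) (u : 'rV[R]_7) (phi : 'cV[R]_8) : 'cV[R]_8 :=
  Lambda_lift s y u *m phi.

Definition form2 : Type := 'rV[R]_7 -> 'rV[R]_7 -> R.
Definition form3 : Type := 'rV[R]_7 -> 'rV[R]_7 -> 'rV[R]_7 -> R.

(* X_i /\ X_j /\ X_k, a vector being identified with a 1-form by the metric. *)
Definition X3 (i j k : nat) : form3 := fun u v w =>
  \det (\matrix_(a < 3, b < 3)
          (nth 0 [:: u; v; w] a) 0 (inord (nth 0%N [:: i; j; k] b).-1)).

Definition interior (u : 'rV[R]_7) (T : form3) : form2 := T u.

Definition clifford2 (w : form2) : 'M[R]_8 :=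
  \sum_(i < 7) \sum_(j < 7 | (i < j)%N)
    w (Xv i.+1) (Xv j.+1) *: (e i.+1 *m e j.+1).

Definition form_of (al be ga de mu nu et : R) : form3 := fun u v w =>
  al * X3 1 3 5 u v w + be * X3 1 4 6 u v w + ga * X3 2 4 5 u v w
  + de * X3 2 3 6 u v w + mu * X3 1 2 7 u v w + nu * X3 3 4 7 u v w
  + et * X3 5 6 7 u v w.

Definition algebraic_form (T : form3) : Prop :=
  exists al be ga de mu nu et : R, T = form_of al be ga de mu nu et.

Definition T4 (s y : R) : form3 := fun u v w =>
  (1 / 2 - y / 4 - (1 + y) / (6 * s) + s / 3)
    * (X3 1 3 5 u v w + X3 1 4 6 u v w)
  + (1 / 2 - y / 4 + (1 + y) / (6 * s) - s / 3)
    * (X3 2 4 5 u v w - X3 2 3 6 u v w)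
  + ((2 * y - 1) / (6 * s) - 2 * s / 3) * X3 1 2 7 u v w
  + ((4 + y) / (12 * s) - 2 * s / 3) * (X3 3 4 7 u v w - X3 5 6 7 u v w).

(* The remaining lemmas check these definitions against each other: the family
   X_i is orthonormal (frame_orthonormal), su(3) = m + R (su3_decomposition),
   Lambda_lift takes the expected values (Lambda_lift_table), and psi 3, ...,
   psi 6 are fixed by the isotropy representation (isotropy_psi). *)

(* X_1, ..., X_7 up to scaling, then Hmx, numbered from 0. *)
Definition base (k : nat) : 'M[R[i]]_3 :=
  nth 0 [:: Amx 1 2; Atmx 1 2; Amx 1 3; Atmx 1 3; Amx 2 3; Atmx 2 3; Lmx; Hmx] k.

Definition ctab : seq (seq (seq (int * int))) :=
  let z := (0, 0) in let o := (1, 0) in let n := (-1, 0) in let i := (0, 1) in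
  [:: [:: [:: z; o; z]; [:: n; z; z]; [:: z; z; z]];
      [:: [:: z; i; z]; [:: i; z; z]; [:: z; z; z]];
      [:: [:: z; z; o]; [:: z; z; z]; [:: n; z; z]];
      [:: [:: z; z; i]; [:: z; z; z]; [:: i; z; z]];
      [:: [:: z; z; z]; [:: z; z; o]; [:: z; n; z]];
      [:: [:: z; z; z]; [:: z; z; i]; [:: z; i; z]];
      [:: [:: (0, 3); z; z]; [:: z; (0, - 3); z]; [:: z; z; z]];
      [:: [:: i; z; z]; [:: z; i; z]; [:: z; z; (0, - 2)]]].

Definition ce (k a b : nat) : int * int :=
  nth (0, 0) (nth [::] (nth [::] ctab k) a) b.

Lemma baseE k (a b : 'I_3) : (k < 8)%N ->
  base k a b = Complex (ce k a b).1%:~R (ce k a b).2%:~R.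
Proof.
by case: a b => [[|[|[|//]]] pa] [[|[|[|//]]] pb];
  do 8?[case: k => [_|k]]; rewrite // /base /ce /= !mxE /=;
  simpc; apply/eqP; rewrite eq_complex /=; apply/andP; split; apply/eqP;
  rewrite ?mulr0n ?mulr1n; ring.
Qed.

Definition gmul (x y : int * int) : int * int :=
  (x.1 * y.1 - x.2 * y.2, x.1 * y.2 + x.2 * y.1).
Definition sum3 (f : nat -> int) : int := f 0%N + f 1%N + f 2%N.
Definition t2 (i j : nat) : int :=
  sum3 (fun a => sum3 (fun b => (gmul (ce i a b) (ce j b a)).1)).
Definition t3 (i j k : nat) : int :=
  sum3 (fun a => sum3 (fun b => sum3 (fun c =>
    (gmul (gmul (ce i a b) (ce j b c)) (ce k c a)).1))).

Definition toC (x : int * int) : R[i] := Complex x.1%:~R x.2%:~R.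
Lemma gmulE x y : toC (gmul x y) = toC x * toC y.
Proof.
by apply/eqP; rewrite eq_complex /= !(rmorphD, rmorphN, rmorphM) /= !eqxx.
Qed.
Lemma ReD (x y : R[i]) : complex.Re (x + y) = complex.Re x + complex.Re y.
Proof. by case: x; case: y. Qed.
Lemma Re_sum3 (f : 'I_3 -> R[i]) (h : nat -> int) :
  (forall a : 'I_3, complex.Re (f a) = (h a)%:~R) ->
  complex.Re (\sum_a f a) = (sum3 h)%:~R.
Proof.
move=> fh; rewrite !big_ord_recl big_ord0 addr0 addrA !ReD !fh /sum3.
by rewrite !rmorphD.
Qed.

Lemma Bbase2 i j : (i < 8)%N -> (j < 8)%N ->
  B (base i) (base j) = - (1 / 2) * (t2 i j)%:~R.
Proof.
move=> hi hj; rewrite /B /mxtrace; congr (_ * _).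
apply: Re_sum3 => a; rewrite mxE; apply: Re_sum3 => b.
by rewrite !baseE // -[Complex _ _]/(toC _) -[X in _ * X]/(toC _) -gmulE.
Qed.

Lemma Bbase3 i j k : (i < 8)%N -> (j < 8)%N -> (k < 8)%N ->
  B (base i) (base j *m base k) = - (1 / 2) * (t3 i j k)%:~R.
Proof.
move=> hi hj hk; rewrite /B mulmxA /mxtrace; congr (_ * _).
apply: Re_sum3 => a; rewrite mxE.
under eq_bigr => c _ do rewrite mxE mulr_suml.
rewrite exchange_big /=.
apply: Re_sum3 => b; apply: Re_sum3 => c.
rewrite !baseE // -[Complex _ _]/(toC _) -[X in _ * X * _]/(toC _).
by rewrite -[X in _ * X]/(toC _) -!gmulE.
Qed.

Lemma ReZ (c : R) (x : R[i]) : complex.Re (c%:C * x) = c * complex.Re x.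
Proof. by case: x => a b /=; rewrite mul0r subr0. Qed.
Lemma BC M N : B M N = B N M.
Proof. by rewrite /B mxtrace_mulC. Qed.
Lemma BDr M N P : B M (N + P) = B M N + B M P.
Proof. by rewrite /B mulmxDr raddfD /= ReD mulrDr. Qed.
Lemma BZr M c N : B M (c%:C *: N) = c * B M N.
Proof. by rewrite /B -scalemxAr linearZ /= ReZ; ring. Qed.
Lemma BNr M N : B M (- N) = - B M N.
Proof. by rewrite /B mulmxN raddfN /=; case: (\tr _) => a b /=; rewrite mulrN. Qed.
Lemma B0r M : B M 0 = 0.
Proof. by rewrite -(scale0r (0 : 'M[R[i]]_3)) (BZr _ 0) mul0r. Qed.
Lemma BZl c M N : B (c%:C *: M) N = c * B M N.
Proof. by rewrite BC BZr BC. Qed.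
Lemma BDl N P M : B (N + P) M = B N M + B P M.
Proof. by rewrite BC BDr BC [B M P]BC. Qed.

Definition bcom (i j : nat) := base i *m base j - base j *m base i.
Definition gam (k i j : nat) : R :=
  - (1 / 2) * (t3 k i j - t3 k j i)%:~R.
Lemma Bcom k i j : (i < 8)%N -> (j < 8)%N -> (k < 8)%N ->
  B (base k) (bcom i j) = gam k i j.
Proof. by move=> *; rewrite BDr BNr !Bbase3 // /gam rmorphB /=; ring. Qed.

Lemma Bbase i j : (i < 8)%N -> (j < 8)%N ->
  B (base i) (base j) =
    if i == j then nth 0 [:: 1; 1; 1; 1; 1; 1; 9; 3] i else 0.
Proof.
move=> hi hj; rewrite Bbase2 //.
suff -> : t2 i j = if i == j then nth 0 [:: -2; -2; -2; -2; -2; -2; -18; -6] i else 0.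
  case: eqP => _; last by rewrite mulr0.
  by do 8?[case: i hi => [_|i hi]] => //=; field.
have /allP chk : all (fun i => all (fun j => t2 i j ==
    if i == j then nth 0 [:: -2; -2; -2; -2; -2; -2; -18; -6] i else 0)
  (iota 0 8)) (iota 0 8) by vm_compute.
have /chk/allP chki : i \in iota 0 8 by rewrite mem_iota.
by apply/eqP/chki; rewrite mem_iota.
Qed.

Lemma sum7 (V : zmodType) (f : nat -> V) :
  \sum_(i < 7) f i = f 0%N + f 1%N + f 2%N + f 3%N + f 4%N + f 5%N + f 6%N.
Proof. by rewrite !big_ord_recr big_ord0 /= add0r. Qed.

Lemma Bproj i M (V : seq nat) : (i < 8)%N -> uniq V -> all (gtn 8) V ->
  B (base i) (proj (map base V) M) = if i \in V then B (base i) M else 0.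
Proof.
move=> hi; rewrite /proj big_map; elim: V => [|j V IH] /=.
  by rewrite big_nil B0r.
case/andP=> jV uV /andP[hj aV]; rewrite big_cons BDr BZr IH // !Bbase // eqxx inE.
case: eqVneq => [->|_] /=; last by rewrite mulr0 add0r.
rewrite (negbTE jV) addr0 mulfVK //.
clear jV; by do 8?[case: j hj => [_|j hj]] => //=; rewrite ?oner_eq0 ?pnatr_eq0.
Qed.

Definition sc (s y : R) (k : nat) : R :=
  nth 0 [:: 1; 1; Num.sqrt y; Num.sqrt y; Num.sqrt y; Num.sqrt y; s / 3] k.
Definition wt (s y : R) (k : nat) : R :=
  nth 0 [:: 1; 1; 1 / y; 1 / y; 1 / y; 1 / y; 1 / s ^+ 2] k.

Lemma frameE (s y : R) k : (k < 7)%N -> frame s y k.+1 = (sc s y k)%:C *: base k.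
Proof.
by do 7?[case: k => [_|k]] => //; rewrite /frame /sc /base /= ?scale1r.
Qed.

Lemma projZ (V : seq ('M[R[i]]_3)) (c : R) (M : 'M[R[i]]_3) : proj V (c%:C *: M) = c%:C *: proj V M.
Proof.
rewrite /proj scaler_sumr; apply: eq_bigr => N _.
by rewrite BZr -mulrA rmorphM scalerA.
Qed.

Lemma proj_base (V : seq nat) k : (k < 8)%N -> uniq V -> all (gtn 8) V ->
  proj (map base V) (base k) = if k \in V then base k else 0.
Proof.
move=> hk; rewrite /proj big_map; elim: V => [|j V IH] /=.
  by rewrite big_nil.
case/andP=> jV uV /andP[hj aV]; rewrite big_cons IH // !Bbase // eqxx inE.
rewrite eq_sym; case: eqVneq => [E|_] /=; last by rewrite mul0r scale0r add0r.
rewrite E (negbTE jV) addr0 divff ?scale1r //.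
clear jV E; by do 8?[case: j hj => [_|j hj]] => //=; rewrite ?oner_eq0 ?pnatr_eq0.
Qed.

Lemma m0E : m0 = map base [:: 6%N]. Proof. by []. Qed.
Lemma m1E : m1 = map base [:: 0%N; 1%N]. Proof. by []. Qed.
Lemma m2E : m2 = map base [:: 2%N; 3%N]. Proof. by []. Qed.
Lemma m3E : m3 = map base [:: 4%N; 5%N]. Proof. by []. Qed.
Lemma proj_mE : proj_m = proj (map base [:: 6; 0; 1; 2; 3; 4; 5]%N).
Proof. by []. Qed.

Definition g_ (V0 V1 V2 V3 : seq 'M[R[i]]_3) (a b : R) M N :=
  a * B (proj V0 M) (proj V0 N) + B (proj V1 M) (proj V1 N)
  + b * B (proj V2 M) (proj V2 N) + b * B (proj V3 M) (proj V3 N).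

Lemma g_E (s y : R) : g s y = g_ m0 m1 m2 m3 (1 / s ^+ 2) (1 / y).
Proof. by []. Qed.

Lemma g_C V0 V1 V2 V3 a b M N : g_ V0 V1 V2 V3 a b M N = g_ V0 V1 V2 V3 a b N M.
Proof.
by rewrite /g_ (BC (proj V0 M)) (BC (proj V1 M)) (BC (proj V2 M)) (BC (proj V3 M)).
Qed.

Lemma g_Zr V0 V1 V2 V3 a b c M N :
  g_ V0 V1 V2 V3 a b M (c%:C *: N) = c * g_ V0 V1 V2 V3 a b M N.
Proof.
rewrite /g_ (projZ V0) (projZ V1) (projZ V2) (projZ V3).
rewrite (BZr (proj V0 M)) (BZr (proj V1 M)) (BZr (proj V2 M)) (BZr (proj V3 M)).
by move: (B _ _) (B _ _) (B _ _) (B _ _) => x0 x1 x2 x3; ring.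
Qed.

Lemma gC (s y : R) M N : g s y M N = g s y N M.
Proof. by rewrite g_E; exact: g_C. Qed.

Lemma gZr (s y c : R) M N : g s y M (c%:C *: N) = c * g s y M N.
Proof. by rewrite g_E; exact: g_Zr. Qed.

Lemma gZl (s y c : R) M N : g s y (c%:C *: M) N = c * g s y M N.
Proof. by rewrite gC gZr gC. Qed.

Lemma g_base (s y : R) M k : (k < 7)%N ->
  g s y M (base k) = wt s y k * B (base k) M.
Proof.
move=> hk; have hk8 : (k < 8)%N by rewrite ltnS ltnW.
have part V : uniq V -> all (gtn 8) V ->
    B (proj (map base V) M) (proj (map base V) (base k)) =
    if k \in V then B (base k) M else 0.
  move=> uV aV; rewrite proj_base //; case: ifP => kV; last by rewrite B0r.
  by rewrite BC Bproj // kV.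
rewrite g_E /g_ m0E m1E m2E m3E !part // !inE.
by do 7?[case: k hk hk8 part => [_ _ _|k hk hk8 part]] => //=; rewrite /wt /=; ring.
Qed.

Lemma g_frame (s y : R) M k : (k < 7)%N ->
  g s y M (frame s y k.+1) = sc s y k * wt s y k * B (base k) M.
Proof. by move=> hk; rewrite frameE // gZr g_base // mulrA. Qed.

Lemma g_proj_m (s y : R) M k : (k < 7)%N ->
  g s y (proj_m M) (base k) = g s y M (base k).
Proof.
move=> hk; have hk8 : (k < 8)%N by rewrite ltnS ltnW.
rewrite !g_base // proj_mE Bproj //.
clear hk8; by do 7?[case: k hk => [_|k hk]].
Qed.

Local Opaque frame g proj base B.

Lemma vec_Xv (s y : R) (i : 'I_7) : vec s y (Xv i.+1) = frame s y i.+1.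
Proof.
rewrite /vec (bigD1 i) //= mxE eqxx scale1r big1 ?addr0 // => j ji.
by rewrite mxE eqSS -val_eqE /= in ji *; rewrite (negbTE ji) scale0r.
Qed.

Lemma bracket_frame (s y : R) i j : (i < 7)%N -> (j < 7)%N ->
  bracket_m (frame s y i.+1) (frame s y j.+1) =
  (sc s y i * sc s y j)%:C *: proj_m (bcom i j).
Proof.
move=> hi hj; rewrite /bracket_m /proj_m (frameE s y hi) (frameE s y hj).
rewrite -!scalemxAl -!scalemxAr !scalerA -!rmorphM (mulrC (sc s y j)).
by rewrite -scalerBr projZ.
Qed.

Definition cst (s y : R) (i j k : nat) : R :=
  sc s y i * sc s y j * sc s y k * wt s y k * gam k i j.

Lemma cstE (s y : R) i j k : (i < 7)%N -> (j < 7)%N -> (k < 7)%N ->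
  g s y (bracket_m (frame s y i.+1) (frame s y j.+1)) (frame s y k.+1) =
  cst s y i j k.
Proof.
move=> hi hj hk; have h8 x : (x < 7 -> x < 8)%N by move=> *; rewrite ltnS ltnW.
rewrite bracket_frame // gZl frameE // gZr g_proj_m // g_base // Bcom ?h8 //.
by rewrite /cst; ring.
Qed.

Lemma levi_civita_Xv (s y : R) (i j k : 'I_7) :
  levi_civita s y (Xv i.+1) (Xv j.+1) 0 k =
  1 / 2 * (cst s y i j k + cst s y k i j + cst s y k j i).
Proof.
rewrite /levi_civita mxE; cbv zeta.
rewrite !vec_Xv; congr (1 / 2 * (_ + _ + _)); first exact: cstE.
  exact: cstE.
by rewrite gC; exact: cstE.
Qed.

Definition gtab (k i j : nat) : int :=
  match k, i, j with
  | 0, 1, 6 | 1, 6, 0 | 6, 0, 1 => (6)%R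
  | 0, 6, 1 | 6, 1, 0 | 1, 0, 6 => (-6)%R
  | 2, 3, 6 | 3, 6, 2 | 6, 2, 3 => (3)%R
  | 2, 6, 3 | 6, 3, 2 | 3, 2, 6 => (-3)%R
  | 4, 5, 6 | 5, 6, 4 | 6, 4, 5 => (-3)%R
  | 4, 6, 5 | 6, 5, 4 | 5, 4, 6 => (3)%R
  | 0, 2, 4 | 2, 4, 0 | 4, 0, 2 => (-1)%R
  | 0, 4, 2 | 4, 2, 0 | 2, 0, 4 => (1)%R
  | 0, 3, 5 | 3, 5, 0 | 5, 0, 3 => (-1)%R
  | 0, 5, 3 | 5, 3, 0 | 3, 0, 5 => (1)%R
  | 1, 2, 5 | 2, 5, 1 | 5, 1, 2 => (1)%R
  | 1, 5, 2 | 5, 2, 1 | 2, 1, 5 => (-1)%R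
  | 1, 3, 4 | 3, 4, 1 | 4, 1, 3 => (-1)%R
  | 1, 4, 3 | 4, 3, 1 | 3, 1, 4 => (1)%R
  | _, _, _ => (0)%R
  end%N.

Lemma gamE k i j : (k < 7)%N -> (i < 7)%N -> (j < 7)%N ->
  gam k i j = (gtab k i j)%:~R.
Proof.
have /allP chk : all (fun k => all (fun i => all (fun j =>
    t3 k i j - t3 k j i == - 2 * gtab k i j) (iota 0 7)) (iota 0 7)) (iota 0 7).
  by vm_compute.
move=> hk hi hj.
have /chk/allP chki : k \in iota 0 7 by rewrite mem_iota.
have /chki/allP chkj : i \in iota 0 7 by rewrite mem_iota.
have /chkj/eqP : j \in iota 0 7 by rewrite mem_iota.
by rewrite /gam => ->; rewrite rmorphM rmorphN /=; field.
Qed.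

Definition Ft (i j a b : nat) : int :=
  ((a.+1 == j) && (b.+1 == i))%:Z - ((a.+1 == i) && (b.+1 == j))%:Z.

Definition et (i a b : nat) : int :=
  match i with
  | 1 => Ft 1 8 a b + Ft 2 7 a b - Ft 3 6 a b - Ft 4 5 a b
  | 2 => - Ft 1 7 a b + Ft 2 8 a b + Ft 3 5 a b - Ft 4 6 a b
  | 3 => - Ft 1 6 a b + Ft 2 5 a b - Ft 3 8 a b + Ft 4 7 a b
  | 4 => - Ft 1 5 a b - Ft 2 6 a b - Ft 3 7 a b - Ft 4 8 a b
  | 5 => - Ft 1 3 a b - Ft 2 4 a b + Ft 5 7 a b + Ft 6 8 a b
  | 6 => Ft 1 4 a b - Ft 2 3 a b - Ft 5 8 a b + Ft 6 7 a b
  | 7 => Ft 1 2 a b - Ft 3 4 a b - Ft 5 6 a b + Ft 7 8 a b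
  | _ => (0)%R
  end.

Lemma FE i j (a b : 'I_8) : F i j a b = (Ft i j a b)%:~R.
Proof. by rewrite mxE /Ft rmorphB /= -!pmulrn. Qed.

Lemma eE i (a b : 'I_8) : e i a b = (et i a b)%:~R.
Proof.
do 8?[case: i => [|i]]; rewrite /e /et ?mxE ?FE //;
  by rewrite ?mxE ?FE ?(rmorphD, rmorphN) /=.
Qed.

Definition sum8 (f : nat -> int) : int := foldr (fun a s => f a + s) 0 (iota 0 8).

Lemma mulmx_et i j (a b : 'I_8) :
  (e i *m e j) a b = (sum8 (fun c => et i a c * et j c b))%:~R.
Proof.
rewrite mxE.
under eq_bigr => c _ do rewrite !eE -rmorphM.
by rewrite -rmorph_sum /= !big_ord_recl big_ord0.
Qed.

Lemma e_anti i j : (0 < i < 8)%N -> (0 < j < 8)%N -> i != j ->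
  e i *m e j = - (e j *m e i).
Proof.
have /allP chk : all (fun i => all (fun j => (i != j) ==>
   all (fun a => all (fun b =>
     sum8 (fun c => et i a c * et j c b) == - sum8 (fun c => et j a c * et i c b))
   (iota 0 8)) (iota 0 8)) (iota 1 7)) (iota 1 7).
  by vm_compute.
move=> hi hj ij; apply/matrixP => a b; rewrite [RHS]mxE !mulmx_et -rmorphN.
have /chk/allP chki : i \in iota 1 7 by rewrite mem_iota.
have /chki/implyP/(_ ij)/allP chkj : j \in iota 1 7 by rewrite mem_iota.
have /chkj/allP chka : val a \in iota 0 8 by rewrite mem_iota ltn_ord.
have /chka/eqP -> // : val b \in iota 0 8 by rewrite mem_iota ltn_ord.
Qed.

Lemma spin_lift_skew (f : 'rV[R]_7 -> 'rV[R]_7) :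
  (forall i j : 'I_7, f (Xv i.+1) 0 j = - f (Xv j.+1) 0 i) ->
  spin_lift f = (1 / 2) *: \sum_(i < 7) \sum_(j < 7 | (i < j)%N)
    f (Xv i.+1) 0 j *: (e i.+1 *m e j.+1).
Proof.
move=> fS; pose G (i j : 'I_7) := f (Xv i.+1) 0 j *: (e i.+1 *m e j.+1).
have GS i j : i != j -> G i j = G j i.
  move=> ij; rewrite /G fS (@e_anti i.+1 j.+1 (ltn_ord i) (ltn_ord j)) ?eqSS //.
  by rewrite scalerN scaleNr opprK.
rewrite /spin_lift (eq_bigr (fun i => \sum_j G i j)) => [|i _]; last first.
  by rewrite /clifford mulmx_sumr; apply: eq_bigr => j _; rewrite -scalemxAr.
have -> : \sum_i \sum_j G i j = 2 *: \sum_(i < 7) \sum_(j < 7 | (i < j)%N) G i j.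
  rewrite scaler_nat mulr2n.
  have G0 i : G i i = 0.
    by rewrite /G (_ : f _ _ _ = 0) ?scale0r //; have := fS i i; lra.
  have -> : \sum_i \sum_j G i j =
     \sum_(i < 7) \sum_(j < 7 | (i < j)%N) G i j + \sum_(i < 7) \sum_(j < 7 | (j < i)%N) G i j.
    rewrite -big_split /=; apply: eq_bigr => i _.
    rewrite (bigID (fun j : 'I_7 => (i < j)%N)) /=; congr (_ + _).
    rewrite (bigD1 i) ?ltnn //= G0 add0r; apply: eq_bigl => j.
    by rewrite -leqNgt [RHS]ltn_neqAle andbC -val_eqE.
  congr (_ + _); rewrite [RHS](exchange_big_dep xpredT) //=.
  by apply: eq_bigr => i _; apply: eq_bigr => j ji; rewrite GS // -val_eqE gtn_eqF.
by rewrite scalerA; congr (_ *: _); field.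
Qed.

Lemma cstN (s y : R) i j k : cst s y i j k = - cst s y j i k.
Proof. by rewrite /cst /gam -[t3 k j i - _]opprB rmorphN; ring. Qed.

Lemma cst_gtab (s y : R) i j k : (i < 7)%N -> (j < 7)%N -> (k < 7)%N ->
  cst s y i j k = sc s y i * sc s y j * sc s y k * wt s y k * (gtab k i j)%:~R.
Proof. by move=> hi hj hk; rewrite /cst gamE. Qed.

Local Opaque levi_civita cst e.

Lemma levi_civita_skew (s y : R) (i j k : 'I_7) :
  levi_civita s y (Xv i.+1) (Xv j.+1) 0 k =
  - levi_civita s y (Xv i.+1) (Xv k.+1) 0 j.
Proof.
apply: etrans (levi_civita_Xv s y i j k) _.
apply: etrans _ (esym (congr1 -%R (levi_civita_Xv s y i k j))).
rewrite (cstN s y i j) (cstN s y k i) (cstN s y k j).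
by move: (cst _ _ _ _ _) (cst _ _ _ _ _) (cst _ _ _ _ _) => p q t; ring.
Qed.

Definition lc (s y : R) (i j k : nat) : R :=
  1 / 2 * (sc s y i * sc s y j * sc s y k) *
  (wt s y k * (gtab k i j)%:~R + wt s y j * (gtab j k i)%:~R
   + wt s y i * (gtab i k j)%:~R).

Lemma Lambda_liftE (s y : R) (i : 'I_7) :
  Lambda_lift s y (Xv i.+1) = (1 / 2) *: \sum_(j < 7) \sum_(k < 7 | (j < k)%N)
    lc s y i j k *: (e j.+1 *m e k.+1).
Proof.
rewrite /Lambda_lift spin_lift_skew => [|j k]; last exact: levi_civita_skew.
congr (_ *: _); apply: eq_bigr => j _; apply: eq_bigr => k _; congr (_ *: _).
apply: etrans (levi_civita_Xv s y i j k) _; rewrite !cst_gtab // /lc.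
by move: (gtab k i j) (gtab j k i) (gtab i k j) => p q t; ring.
Qed.

Lemma sum21 (V : zmodType) (G : nat -> nat -> V) :
  \sum_(j < 7) \sum_(k < 7 | (j < k)%N) G j k =
  \sum_(p <- [seq (j, k) | j <- iota 0 7, k <- iota 0 7] | (p.1 < p.2)%N) G p.1 p.2.
Proof.
rewrite [RHS]big_mkcond big_allpairs -(big_mkord xpredT (fun j => \sum_(k < 7 | (j < k)%N) G j k)).
by apply: eq_bigr => j _; rewrite -(big_mkord (fun k => (j < k)%N) (G j)) [LHS]big_mkcond.
Qed.

Definition nzp (i : nat) : seq (nat * nat) :=
  [seq p <- [seq (j, k) | j <- iota 0 7, k <- iota 0 7] |
     (p.1 < p.2)%N && ~~ [&& gtab p.2 i p.1 == 0, gtab p.1 p.2 i == 0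
                           & gtab i p.2 p.1 == 0]].

Lemma Lambda_lift_nzp (s y : R) i : (i < 7)%N ->
  Lambda_lift s y (Xv i.+1) = (1 / 2) *:
    \sum_(p <- nzp i) lc s y i p.1 p.2 *: (e p.1.+1 *m e p.2.+1).
Proof.
move=> hi; rewrite (Lambda_liftE s y (Ordinal hi)); congr (_ *: _).
rewrite (sum21 (fun j k => lc s y i j k *: (e j.+1 *m e k.+1))) /nzp big_filter.
rewrite [RHS]big_mkcondr /=; apply: eq_bigr => p _.
case: ifP => // /negbFE /and3P[/eqP h1 /eqP h2 /eqP h3].
by rewrite /lc h1 h2 h3 !mulr0 !addr0 mulr0 scale0r.
Qed.

Lemma Lambda_lift_table (s y : R) (hs : 0 < s) (hy : 0 < y) :
  let h := 1 / 2 - y / 4 in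
  let E i j := e i *m e j in
  [/\ Lambda_lift s y (Xv 1)
        = (1 / (2 * s)) *: E 2 7 - h *: (E 3 5 + E 4 6),
      Lambda_lift s y (Xv 2)
        = - (1 / (2 * s)) *: E 1 7 - h *: (E 4 5 - E 3 6),
      Lambda_lift s y (Xv 3)
        = (y / (4 * s)) *: E 4 7 - (y / 4) *: (E 2 6 - E 1 5)
    & Lambda_lift s y (Xv 4)
        = - (y / (4 * s)) *: E 3 7 + (y / 4) *: (E 1 6 + E 2 5)] /\
  [/\ Lambda_lift s y (Xv 5)
        = - (y / (4 * s)) *: E 6 7 - (y / 4) *: (E 1 3 + E 2 4),
      Lambda_lift s y (Xv 6)
        = (y / (4 * s)) *: E 5 7 - (y / 4) *: (E 1 4 - E 2 3)
    & Lambda_lift s y (Xv 7)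
        = (s / 2) *: (2 *: E 1 2 + E 3 4 - E 5 6) - (1 / (2 * s)) *: E 1 2
          - (y / (4 * s)) *: E 3 4 + (y / (4 * s)) *: E 5 6].
Proof.
move=> h E.
have [r r0 yE] : exists2 r, 0 < r & y = r ^+ 2.
  by exists (Num.sqrt y); rewrite ?sqrtr_gt0 // sqr_sqrtr // ltW.
have sE : Num.sqrt y = r by rewrite yE sqrtr_sqr gtr0_norm.
have r0' : r != 0 by rewrite gt_eqF.
have s0' : s != 0 by rewrite gt_eqF.
have nz0 : nzp 0 = [:: (1, 6); (2, 4); (3, 5)]%N by vm_compute.
have nz1 : nzp 1 = [:: (0, 6); (2, 5); (3, 4)]%N by vm_compute.
have nz2 : nzp 2 = [:: (0, 4); (1, 5); (3, 6)]%N by vm_compute.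
have nz3 : nzp 3 = [:: (0, 5); (1, 4); (2, 6)]%N by vm_compute.
have nz4 : nzp 4 = [:: (0, 2); (1, 3); (5, 6)]%N by vm_compute.
have nz5 : nzp 5 = [:: (0, 3); (1, 2); (4, 6)]%N by vm_compute.
have nz6 : nzp 6 = [:: (0, 1); (2, 3); (4, 5)]%N by vm_compute.
do 2!split; rewrite Lambda_lift_nzp // ?nz0 ?nz1 ?nz2 ?nz3 ?nz4 ?nz5 ?nz6.
all: rewrite !big_cons big_nil addr0 /lc /gtab /wt /sc /= sE /E /h yE.
all: repeat match goal with |- context [?M *m ?N] => move: (M *m N) => ? end.
all: apply/matrixP => a b; rewrite !mxE.
all: by field; rewrite ?r0' ?s0'.
Qed.

Local Transparent frame g proj base B levi_civita cst e.

Lemma sc_wt (s y : R) i : 0 < s -> 0 < y -> (i < 7)%N ->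
  sc s y i * wt s y i * sc s y i * nth 0 [:: 1; 1; 1; 1; 1; 1; 9] i = 1.
Proof.
move=> s0 y0 hi; have s0' : s != 0 by rewrite gt_eqF.
have y0' : y != 0 by rewrite gt_eqF.
have yE : Num.sqrt y ^+ 2 = y by rewrite sqr_sqrtr // ltW.
have H4 : Num.sqrt y * (1 / y) * Num.sqrt y * 1 = 1.
  by rewrite mulr1 mulrAC -expr2 yE mulrA mulr1 divff.
by do 7?[case: i hi => [_|i hi]] => //; rewrite /sc /wt /= ?H4 //; field.
Qed.

Lemma frame_orthonormal (s y : R) (i j : 'I_7) : 0 < s -> 0 < y ->
  g s y (frame s y i.+1) (frame s y j.+1) = (i == j)%:R.
Proof.
move=> s0 y0; rewrite (g_frame s y _ (ltn_ord j)) (frameE s y (ltn_ord i)) BZr.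
have h8 (k : 'I_7) : (k < 8)%N by rewrite ltnS ltnW.
rewrite Bbase // [(j : nat) == i]eq_sym -[i == j]/(i == j :> nat).
case: eqP => [->|_] /=; last by rewrite !mulr0.
rewrite mulrA; apply: etrans (sc_wt s0 y0 (ltn_ord j)); congr (_ * _).
by case: j => -[|[|[|[|[|[|[|//]]]]]]].
Qed.

Definition htab (k i : nat) : int :=
  match k, i with
  | 3, 2 | 5, 4 => (3)%R
  | 2, 3 | 4, 5 => (-3)%R
  | _, _ => (0)%R
  end%N.

Lemma gam_htab k i : (k < 7)%N -> (i < 7)%N -> gam k 7 i = (htab k i)%:~R.
Proof.
have /allP chk : all (fun k => all (fun i =>
    t3 k 7 i - t3 k i 7 == - 2 * htab k i) (iota 0 7)) (iota 0 7).
  by vm_compute.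
move=> hk hi.
have /chk/allP chki : k \in iota 0 7 by rewrite mem_iota.
have /chki/eqP : i \in iota 0 7 by rewrite mem_iota.
by rewrite /gam => ->; rewrite rmorphM rmorphN /=; field.
Qed.

Lemma isotropyE (s y : R) (i k : 'I_7) : 0 < s -> 0 < y ->
  isotropy s y (Xv i.+1) 0 k = (htab k i)%:~R.
Proof.
move=> s0 y0; rewrite /isotropy /coords mxE vec_Xv (frameE s y (ltn_ord i)).
rewrite -scalemxAl -scalemxAr -scalerBr gZl (g_frame s y _ (ltn_ord k)).
have h8 (j : 'I_7) : (j < 8)%N by rewrite ltnS ltnW.
have -> : B (base k) (Hmx *m base i - base i *m Hmx) = gam k 7 i.
  exact: (@Bcom k 7 i).
rewrite gam_htab // !mulrA.
have y0' : y != 0 by rewrite gt_eqF.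
have yE : Num.sqrt y ^+ 2 = y by rewrite sqr_sqrtr // ltW.
have H : Num.sqrt y * Num.sqrt y * (1 / y) = 1 by rewrite -expr2 yE mulrA mulr1 divff.
move: (val i) (val k) (ltn_ord i) (ltn_ord k) => {h8} {}i {}k hi hk.
do 7?[case: i hi => [_|i hi]] => //; do 7?[case: k hk => [_|k hk]] => //.
all: by rewrite /sc /wt [nth _ _ _]/= [nth _ _ _]/= [htab _ _]/= ?H ?mul1r ?mulr0.
Qed.

Lemma isotropy_lift (s y : R) : 0 < s -> 0 < y ->
  spin_lift (isotropy s y) = (3 / 2) *: (e 3 *m e 4 + e 5 *m e 6).
Proof.
move=> s0 y0; rewrite spin_lift_skew => [|i j]; last first.
  apply: etrans (isotropyE i j s0 y0) _.
  apply: etrans _ (esym (congr1 -%R (isotropyE j i s0 y0))).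
  rewrite -rmorphN; congr _%:~R.
  move: (val i) (val j) (ltn_ord i) (ltn_ord j) => {}i {}j hi hj.
  by do 7?[case: i hi => [_|i hi]] => //; do 7?[case: j hj => [_|j hj]].
pose G (i j : nat) := (htab j i)%:~R *: (e i.+1 *m e j.+1) : 'M[R]_8.
have -> : \sum_(i < 7) \sum_(j < 7 | (i < j)%N)
    isotropy s y (Xv i.+1) 0 j *: (e i.+1 *m e j.+1) =
  \sum_(i < 7) \sum_(j < 7 | (i < j)%N) G i j.
  by apply: eq_bigr => i _; apply: eq_bigr => j _; congr (_ *: _); exact: isotropyE.
rewrite sum21 (bigID (fun p : nat * nat => htab p.2 p.1 == 0)) /=.
rewrite [X in X + _]big1 ?add0r => [|p /andP[_ /eqP h]]; last first.
  by rewrite /G h scale0r.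
rewrite -big_filter.
have -> : [seq p <- [seq (j, k) | j <- iota 0 7, k <- iota 0 7] |
    (p.1 < p.2)%N & htab p.2 p.1 != 0] = [:: (2, 3); (4, 5)]%N by vm_compute.
rewrite !big_cons big_nil addr0 -scalerDr scalerA; congr (_ *: _).
by rewrite /=; field.
Qed.

Lemma isotropy_psi (s y : R) k : 0 < s -> 0 < y -> (3 <= k <= 6)%N ->
  spin_lift (isotropy s y) *m psi k = 0.
Proof.
move=> s0 y0 hk; rewrite isotropy_lift // -scalemxAl.
suff -> : (e 3 *m e 4 + e 5 *m e 6) *m psi k = 0 by rewrite scaler0.
have /allP chk : all (fun a => all (fun b =>
    sum8 (fun c => et 3 a c * et 4 c b) + sum8 (fun c => et 5 a c * et 6 c b) == 0)
  (iota 2 4)) (iota 0 8) by vm_compute.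
apply/matrixP => a j; rewrite mxE [RHS]mxE big1 // => b _.
rewrite [psi k b j]mxE; case: eqP => [bk|_]; last by rewrite mulr0.
rewrite mxE !mulmx_et -rmorphD /=.
have /chk/allP chka : val a \in iota 0 8 by rewrite mem_iota ltn_ord.
have hb : val b \in iota 2 4 by rewrite mem_iota; move: hk; rewrite -bk.
by apply/eqP; rewrite mulf_eq0 intr_eq0; apply/orP; left; exact: chka.
Qed.

Lemma su3_coef (M : 'M[R[i]]_3) : su3 M ->
  exists c : nat -> R, M = \sum_(k < 8) (c k)%:C *: base k.
Proof.
case=> /matrixP hM hT.
pose re (a b : nat) := complex.Re (M (inord a) (inord b)).
pose im (a b : nat) := complex.Im (M (inord a) (inord b)).
exists (fun k => nth 0 [:: re 0 1; im 0 1; re 0 2; im 0 2; re 1 2; im 1 2;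
  (im 0 0 - im 1 1) / 6; (im 0 0 + im 1 1) / 2]%N k).
have hr a b : re a b = - re b a /\ im a b = im b a.
  have := hM (inord b) (inord a); rewrite !mxE /re /im.
  case: (M (inord a) (inord b)) => p q; case: (M (inord b) (inord a)) => p' q' /= [h1 h2].
  split; lra.
have ht : im 0 0 + im 1 1 + im 2 2 = 0.
  move: hT; rewrite /mxtrace !big_ord_recl big_ord0 => /(congr1 (@complex.Im R)).
  have i0 : ord0 = inord 0 :> 'I_3 by apply: val_inj; rewrite /= inordK.
  have i1 : lift ord0 ord0 = inord 1 :> 'I_3 by apply: val_inj; rewrite /= inordK.
  have i2 : lift ord0 (lift ord0 ord0) = inord 2 :> 'I_3.
    by apply: val_inj; rewrite /= inordK.
  rewrite i2 i1 i0 /im.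
  case: (M (inord 0) (inord 0)) => p q; case: (M (inord 1) (inord 1)) => p' q'.
  by case: (M (inord 2) (inord 2)) => p'' q'' /= h; lra.
have h8 (k : 'I_8) : (k < 8)%N by [].
apply/matrixP => a b; rewrite summxE.
under eq_bigr => k _ do rewrite mxE baseE //.
rewrite !big_ord_recl big_ord0 /= /bump /=.
have -> : M a b = Complex (re a b) (im a b) by rewrite /re /im !inord_val; case: (M a b).
have [r00 _] := hr 0 0; have [r11 _] := hr 1 1; have [r22 _] := hr 2 2.
have [r10 i10] := hr 1 0; have [r20 i20] := hr 2 0; have [r21 i21] := hr 2 1.
by case: a b => [[|[|[|//]]] pa] [[|[|[|//]]] pb]; rewrite /ce /=; simpc;
  apply/eqP; rewrite eq_complex /=; apply/andP; split; apply/eqP; lra.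
Qed.

Lemma projD (V : seq 'M[R[i]]_3) (M N : 'M[R[i]]_3) : proj V (M + N) = proj V M + proj V N.
Proof.
rewrite /proj -big_split /=; apply: eq_bigr => P _.
by rewrite BDr mulrDl rmorphD scalerDl.
Qed.

Lemma su3_decomposition (M : 'M[R[i]]_3) : su3 M ->
  exists t : R, M = proj_m M + t%:C *: Hmx.
Proof.
case/su3_coef => c ME; exists (c 7).
pose S n := \sum_(k < n) (c k)%:C *: base k.
have SE n : (n <= 7)%N -> proj_m (S n) = S n.
  rewrite /S; elim: n => [|n IH] hn.
    rewrite big_ord0; apply: etrans (_ : 0%:C *: proj_m 0 = _); last by rewrite scale0r.
    by rewrite -projZ scaler0.
  rewrite big_ord_recr /= /proj_m projD projZ -/proj_m; congr (_ + _ *: _).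
    exact: IH (ltnW hn).
  apply: etrans (@proj_base [:: 6; 0; 1; 2; 3; 4; 5]%N n (ltnW hn) isT isT) _.
  by clear IH; do 7?[case: n hn => [|n] hn].
have H0 : proj_m Hmx = 0 :> 'M[R[i]]_3.
  exact: (@proj_base [:: 6; 0; 1; 2; 3; 4; 5]%N 7 isT isT isT).
have {}ME : M = S 7 + (c 7)%:C *: Hmx by rewrite ME big_ord_recr.
rewrite [in RHS]ME /proj_m projD projZ -/proj_m.
apply: etrans ME _; congr (_ + _).
apply: etrans (esym (SE 7 isT)) _.
by apply: esym; apply: etrans (congr1 (fun X => _ + _ *: X) H0) _; rewrite scaler0 addr0.
Qed.

End Geometry.

(* Main.v *)
Require Import Defs.
From mathcomp Require Import all_boot all_order all_algebra.
From mathcomp Require Import reals.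
From mathcomp Require Import boolp ring lra.
From mathcomp.real_closed Require Import complex.

Set Implicit Arguments.
Unset Strict Implicit.
Unset Printing Implicit Defensive.

Import Order.TTheory GRing.Theory Num.Theory.

Local Open Scope ring_scope.

(** The spinor psi = psi 4 defines a G_2-structure on m: the 3-form
    phi = X135 + X146 - X245 + X236 + X127 + X347 - X567, whose seven terms are
    the lines of a Fano plane with points 1, ..., 7.  For each line {i,j,k}
    with sign c one has X_i X_j psi = - c X_k psi, and cyclically
    (lines4_rules).  Each 3-form T of the given family is a combination of the
    same seven terms, so contracting T with X_i and acting on psi gives a
    multiple of X_i psi; the factor is minus the signed sum of the coefficients
    of the three lines through i (form_psi4).

    The bivectors in the spin lift of the connection along X_i are again those
    that complete i to a line, so nabla_{X_i} psi is a multiple of X_i psi as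
    well (nabla_Xv_psi4).  As X_i psi is nonzero and both terms of the equation
    are linear in X, the equation becomes one scalar equation for each point i
    (killing_psi4P): the sum of the signed coefficients over the lines through
    i is prescribed.  The matrix of this system is the signed incidence matrix
    of the Fano plane, which is invertible because two lines meet in exactly
    one point (line_sums_inj).  Hence there is at most one solution, and
    the coefficients of T4 are verified to be one. *)

(** * Linearity of the covariant derivative in the direction *)

Lemma linear_rV_sum (R : nzRingType) (n : nat) (V : lmodType R)
    (f : 'rV[R]_n -> V) : linear f ->
  forall u, f u = \sum_i u 0 i *: f (delta_mx 0 i).
Proof.
move=> lf u.
have fD : {morph f : x y / x + y}.
  by move=> x y; have := lf 1 x y; rewrite !scale1r.
have f0 : f 0 = 0.
  by apply: (addIr (f 0)); rewrite -fD !add0r.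
rewrite {1}(row_sum_delta u) (big_morph f fD f0); apply: eq_bigr => i _ /=.
by rewrite -[_ *: delta_mx _ _]addr0 lf f0 addr0.
Qed.

Section Connection.
Variables (R : realType) (s y : R).
Local Notation mx := 'M[R[i]%C]_3.

Lemma vec_linear a (u v : 'rV[R]_7) :
  vec s y (a *: u + v) = (a%:C)%C *: vec s y u + vec s y v.
Proof.
rewrite /vec scaler_sumr -big_split; apply: eq_bigr => i _ /=.
by rewrite !mxE rmorphD rmorphM scalerDl scalerA.
Qed.

(** Stated with arbitrary families V0, ..., V3 in place of m0, ..., m3, as
    unification would otherwise unfold their explicit matrices. *)
Lemma g__linearl V0 V1 V2 V3 b c a (M N P : mx) :
  g_ V0 V1 V2 V3 b c ((a%:C)%C *: M + N) P
  = a * g_ V0 V1 V2 V3 b c M P + g_ V0 V1 V2 V3 b c N P.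
Proof.
rewrite /g_ !projD !projZ !BDl !BZl.
by repeat move: (B _ _) => ?; ring.
Qed.

Lemma g_linearl a (M N P : mx) :
  g s y ((a%:C)%C *: M + N) P = a * g s y M P + g s y N P.
Proof. by rewrite g_E; exact: g__linearl. Qed.

Lemma bracket_linearl a (M N P : mx) :
  bracket_m ((a%:C)%C *: M + N) P
  = (a%:C)%C *: bracket_m M P + bracket_m N P.
Proof.
rewrite /bracket_m /proj_m -projZ -projD; congr proj.
by rewrite mulmxDl mulmxDr -scalemxAl -scalemxAr scalerBr opprD addrACA.
Qed.

Lemma bracket_linearr a (M N P : mx) :
  bracket_m P ((a%:C)%C *: M + N)
  = (a%:C)%C *: bracket_m P M + bracket_m P N.
Proof.
rewrite /bracket_m /proj_m -projZ -projD; congr proj.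
by rewrite mulmxDl mulmxDr -scalemxAl -scalemxAr scalerBr opprD addrACA.
Qed.

(** The right-hand side of the Koszul formula, for an arbitrary form h and
    bracket br: its linearity in X is then a formal consequence of theirs, in
    which no explicit matrix occurs. *)
Definition koszul (h : mx -> mx -> R) (br : mx -> mx -> mx) (X Y Z : mx) : R :=
  1 / 2 * (h (br X Y) Z + h (br Z X) Y + h X (br Z Y)).

Lemma koszul_linear (h : mx -> mx -> R) (br : mx -> mx -> mx)
    (hl : forall a M N P, h ((a%:C)%C *: M + N) P = a * h M P + h N P)
    (brl : forall a M N P,
       br ((a%:C)%C *: M + N) P = (a%:C)%C *: br M P + br N P)
    (brr : forall a M N P,
       br P ((a%:C)%C *: M + N) = (a%:C)%C *: br P M + br P N)
    (a : R) (X X' Y Z : mx) :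
  koszul h br ((a%:C)%C *: X + X') Y Z
  = a * koszul h br X Y Z + koszul h br X' Y Z.
Proof. by rewrite /koszul brl brr !hl; ring. Qed.

Lemma levi_civitaE (u v : 'rV[R]_7) (k : 'I_7) :
  levi_civita s y u v 0 k
  = koszul (g s y) (@bracket_m R) (vec s y u) (vec s y v) (frame s y k.+1).
Proof. exact: mxE. Qed.

Lemma levi_civita_linear a (u v w : 'rV[R]_7) :
  levi_civita s y (a *: u + v) w
  = a *: levi_civita s y u w + levi_civita s y v w.
Proof.
apply/rowP => k; rewrite [RHS]mxE [X in _ = X + _]mxE.
(* Chaining equalities avoids the matching modulo conversion of rewrite, which
   would unfold the explicit matrices below the connection. *)
apply: etrans (levi_civitaE _ _ _) _.
apply: etrans (congr1 (fun X => koszul _ _ X _ _) (vec_linear a u v)) _.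
apply: etrans (koszul_linear g_linearl bracket_linearl bracket_linearr _ _ _ _ _) _.
by congr (_ * _ + _); apply: esym; exact: levi_civitaE.
Qed.

Lemma clifford_linear a (u v : 'rV[R]_7) :
  clifford (a *: u + v) = a *: clifford u + clifford v.
Proof.
rewrite /clifford scaler_sumr -big_split; apply: eq_bigr => i _ /=.
by rewrite !mxE scalerDl scalerA.
Qed.

Lemma spin_lift_linear a (f1 f2 f : 'rV[R]_7 -> 'rV[R]_7) :
  (forall w, f w = a *: f1 w + f2 w) ->
  spin_lift f = a *: spin_lift f1 + spin_lift f2.
Proof.
move=> fE; rewrite /spin_lift scalerA [a * _]mulrC -[(_ * a) *: _]scalerA -scalerDr.
congr (_ *: _); rewrite scaler_sumr -big_split; apply: eq_bigr => i _ /=.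
by rewrite fE clifford_linear mulmxDr scalemxAr.
Qed.

Lemma nabla_linear (phi : 'cV[R]_8) : linear (fun u => nabla s y u phi).
Proof.
move=> a u v; rewrite /nabla scalemxAl -mulmxDl; congr (_ *m _).
by apply: spin_lift_linear; exact: levi_civita_linear.
Qed.

Lemma Xv_delta (i : 'I_7) : Xv R i.+1 = delta_mx 0 i.
Proof. by apply/rowP => j; rewrite !mxE eqSS. Qed.

Lemma nabla_sum (u : 'rV[R]_7) (phi : 'cV[R]_8) :
  nabla s y u phi = \sum_(i < 7) u 0 i *: nabla s y (Xv R i.+1) phi.
Proof.
rewrite (linear_rV_sum (nabla_linear phi)).
by apply: eq_bigr => i _; rewrite Xv_delta.
Qed.

End Connection.

Arguments e R i : simpl never.

(** * Clifford action of a contracted 3-form *)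

Section Contraction.
Variable R : realType.
Implicit Types (u v w : 'rV[R]_7).

(** The coordinate numbered from 1, as it occurs in X3. *)
Definition crd u (i : nat) : R := u 0 (inord i.-1).

Definition wedge2 (i j : nat) : form2 R := fun v w =>
  crd v i * crd w j - crd v j * crd w i.

Lemma crd_Xv (i : 'I_7) j : (0 < j < 8)%N -> crd (Xv R i.+1) j = (i.+1 == j)%:R.
Proof.
case: j => // j hj; rewrite /crd mxE inordK //.
by rewrite [RHS]/= eqSS eq_sym.
Qed.

(** Laplace expansion along the first argument; it makes the contraction with
    u a combination of decomposable 2-forms, linear in u. *)
Lemma X3E i j k u v w :
  X3 i j k u v w = crd u i * wedge2 j k v w - crd u j * wedge2 i k v w
                   + crd u k * wedge2 i j v w.
Proof.
rewrite /X3 (expand_det_row _ ord0) !big_ord_recl big_ord0 /cofactor.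
rewrite ![\det (row' _ _)](expand_det_row _ ord0) !big_ord_recl !big_ord0 /cofactor.
rewrite !det_mx11 !mxE /= /wedge2 /crd.
ring.
Qed.

Lemma clifford2D (p q : form2 R) :
  clifford2 (fun v w => p v w + q v w) = clifford2 p + clifford2 q.
Proof.
rewrite /clifford2 -big_split; apply: eq_bigr => i _ /=.
by rewrite -big_split; apply: eq_bigr => j _ /=; rewrite scalerDl.
Qed.

Lemma clifford2Z a (p : form2 R) :
  clifford2 (fun v w => a * p v w) = a *: clifford2 p.
Proof.
rewrite /clifford2 scaler_sumr; apply: eq_bigr => i _ /=.
by rewrite scaler_sumr; apply: eq_bigr => j _ /=; rewrite scalerA.
Qed.

(** Only the pair (i, j) survives among the increasing pairs of indices. *)
Lemma clifford2_wedge2 i j : (0 < i < j)%N -> (j < 8)%N ->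
  clifford2 (wedge2 i j) = e R i *m e R j.
Proof.
case: i j => [|i] [|j] // /andP[_ ij] hj; rewrite ltnS in ij; rewrite ltnS in hj.
have hi : (i < 7)%N := ltn_trans ij hj.
have ltS (a : nat) : (a < 7)%N -> (0 < a.+1 < 8)%N by [].
have val_w (a b : 'I_7) : (a < b)%N ->
    wedge2 i.+1 j.+1 (Xv R a.+1) (Xv R b.+1)
    = ((a == Ordinal hi) && (b == Ordinal hj))%:R.
  (* The transposed term needs a = j and b = i, against a < b and i < j. *)
  move=> ab; rewrite /wedge2 !crd_Xv ?ltS // !eqSS -!val_eqE /=.
  rewrite -!natrM !mulnb.
  rewrite [X in _ - X%:R](_ : _ = 0%N) ?subr0 //.
  case: eqP => //= aj; case: eqP => //= bi; move: ab ij; rewrite aj bi.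
  by move/ltnW; rewrite leqNgt => /negbTE ->.
rewrite /clifford2 (bigD1 (Ordinal hi)) //= [X in _ + X]big1 => [|a ai].
  rewrite addr0 (bigD1 (Ordinal hj)) //= big1 => [|b /andP[ab bj]].
    by rewrite (val_w (Ordinal hi) (Ordinal hj)) // !eqxx scale1r addr0.
  by rewrite (val_w (Ordinal hi) b) // (negbTE bj) andbF scale0r.
by apply: big1 => b ab; rewrite val_w // (negbTE ai) scale0r.
Qed.

Lemma clifford2_interior_X3 i j k u :
  (0 < i < j)%N -> (j < k)%N -> (k < 8)%N ->
  clifford2 (interior u (X3 i j k)) =
    crd u i *: (e R j *m e R k) - crd u j *: (e R i *m e R k)
    + crd u k *: (e R i *m e R j).
Proof.
move=> hij jk hk; have /andP[i0 ij] := hij.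
have j0 := ltn_trans i0 ij; have ik := ltn_trans ij jk.
rewrite -!clifford2_wedge2 ?i0 ?j0 ?ij ?ik ?jk ?hk ?(ltn_trans jk hk) //.
rewrite -scaleNr -!clifford2Z -!clifford2D; congr clifford2.
by apply/funext => v; apply/funext => w; rewrite /interior X3E mulNr.
Qed.

Lemma clifford2_interior_form al be ga de mu nu et u :
  clifford2 (interior u (form_of al be ga de mu nu et)) =
    al *: clifford2 (interior u (X3 1 3 5))
    + be *: clifford2 (interior u (X3 1 4 6))
    + ga *: clifford2 (interior u (X3 2 4 5))
    + de *: clifford2 (interior u (X3 2 3 6))
    + mu *: clifford2 (interior u (X3 1 2 7))
    + nu *: clifford2 (interior u (X3 3 4 7))
    + et *: clifford2 (interior u (X3 5 6 7)).
Proof. by rewrite -!clifford2Z -!clifford2D. Qed.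

End Contraction.

(** * The Fano plane of the spinor *)

Section Lines.
Variable R : realType.

(** Multiplying by psi k thus selects a column, so that products of the e i
    acting on it reduce to integer computations. *)
Lemma psi_delta (k : 'I_8) : psi R k.+1 = delta_mx k 0.
Proof. by apply/colP => a; rewrite !mxE eqSS andbT. Qed.

Lemma e_sqr i : (0 < i < 8)%N -> e R i *m e R i = - 1%:M.
Proof.
have /allP chk : all (fun i => all (fun a => all (fun b =>
     sum8 (fun c => et i a c * et i c b) == - (a == b)%:Z)
   (iota 0 8)) (iota 0 8)) (iota 1 7).
  by vm_compute.
move=> hi; apply/matrixP => a b; rewrite mulmx_et !mxE.
have /chk/allP chki : i \in iota 1 7 by rewrite mem_iota.
have /chki/allP chka : val a \in iota 0 8 by rewrite mem_iota ltn_ord.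
have /chka/eqP -> : val b \in iota 0 8 by rewrite mem_iota ltn_ord.
by rewrite rmorphN -val_eqE.
Qed.

(** Multiplying by e i once more gives minus the spinor, which is nonzero. *)
Lemma e_psi_neq0 i (k : 'I_8) : (0 < i < 8)%N -> e R i *m psi R k.+1 != 0.
Proof.
move=> hi; apply/eqP => h0; have := congr1 (mulmx (e R i)) h0.
rewrite mulmxA e_sqr // mulmx0 mulNmx mul1mx => /colP/(_ k)/eqP.
by rewrite !mxE eqxx oppr_eq0 oner_eq0.
Qed.

(** On a fixed spinor, one product X_i X_j phi = c X_k phi determines the other
    two products along the line {i,j,k}, by the Clifford relations alone. *)
Lemma line_products i j k (c : R) (phi : 'cV[R]_8) :
  (0 < i < j)%N -> (j < 8)%N -> c ^+ 2 = 1 ->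
  e R i *m (e R j *m phi) = c *: (e R k *m phi) ->
  e R i *m (e R k *m phi) = - c *: (e R j *m phi)
  /\ e R j *m (e R k *m phi) = c *: (e R i *m phi).
Proof.
move=> /andP[i0 ij] j8 c2 hijk.
have hi : (0 < i < 8)%N by rewrite i0 (ltn_trans ij).
have hj : (0 < j < 8)%N by rewrite (ltn_trans i0 ij).
have -> : e R k *m phi = c *: (e R i *m (e R j *m phi)).
  by rewrite hijk scalerA -expr2 c2 scale1r.
split; rewrite -scalemxAr.
  by rewrite (mulmxA (e R i) (e R i)) e_sqr // mulNmx mul1mx scalerN scaleNr.
rewrite (mulmxA (e R j) (e R i)) e_anti ?mulNmx //; last by rewrite gtn_eqF.
rewrite -(mulmxA (e R i)) (mulmxA (e R j)) e_sqr // mulNmx mul1mx.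
by rewrite mulmxN opprK.
Qed.

(** The signed terms c X_ijk of the G_2-form of psi 4; the sign is fixed by
    lines4_product. *)
Definition lines4 : seq (nat * nat * nat * int) :=
  [:: (1, 3, 5, 1%R); (1, 4, 6, 1%R); (2, 4, 5, -1%R); (2, 3, 6, 1%R);
      (1, 2, 7, 1%R); (3, 4, 7, 1%R); (5, 6, 7, -1%R)]%N.

Lemma lines4_product i j k c : (i, j, k, c) \in lines4 ->
  e R i *m (e R j *m psi R 4) = - c%:~R *: (e R k *m psi R 4).
Proof.
have /allP chk : all (fun l : nat * nat * nat * int =>
   let: (i, j, k, c) := l in all (fun a =>
     sum8 (fun b => et i a b * et j b 3) == - c * et k a 3)
   (iota 0 8)) lines4.
  by vm_compute.
move=> /chk/allP {}chk; pose p3 : 'I_8 := Ordinal (isT : (3 < 8)%N).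
(* psi 4 is the column with index 3, as indices start from 0. *)
rewrite -[4%N]/(p3.+1) psi_delta mulmxA -!colE; apply/colP => a.
rewrite mxE [RHS]mxE mulmx_et [X in _ * X]mxE eE -rmorphN -rmorphM.
by congr _%:~R; apply/eqP/chk; rewrite mem_iota ltn_ord.
Qed.

Lemma lines4_rules i j k c : (i, j, k, c) \in lines4 ->
  (e R i *m (e R j *m psi R 4) = - c%:~R *: (e R k *m psi R 4))
  * (e R i *m (e R k *m psi R 4) = c%:~R *: (e R j *m psi R 4))
  * (e R j *m (e R k *m psi R 4) = - c%:~R *: (e R i *m psi R 4)).
Proof.
move=> hl; have hp := lines4_product hl.
have /allP chk : all (fun l : nat * nat * nat * int =>
   let: (i, j, k, c) := l in [&& 0 < i < j, j < 8 & c ^+ 2 == 1]%N) lines4.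
  by [].
have /and3P[hij hj /eqP c2] := chk _ hl.
have c2R : (- c%:~R) ^+ 2 = 1 :> R by rewrite sqrrN -rmorphXn c2.
have [hp2 hp3] := line_products hij hj c2R hp.
by rewrite opprK in hp2.
Qed.

(** For each point of the line, contracting with it leaves the bivector of the
    other two; it sends psi 4 to the product of psi 4 with that point, with the
    same factor - c for all three points. *)
Lemma line_interior_psi4 i j k c (u : 'rV[R]_7) : (i, j, k, c) \in lines4 ->
  clifford2 (interior u (X3 i j k)) *m psi R 4 =
    - c%:~R *: (crd u i *: (e R i *m psi R 4) + crd u j *: (e R j *m psi R 4)
                + crd u k *: (e R k *m psi R 4)).
Proof.
move=> hl; have rules := lines4_rules hl.
have /allP chk : all (fun l : nat * nat * nat * int =>
   let: (i, j, k, c) := l in [&& 0 < i < j, j < k & k < 8]%N) lines4.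
  by [].
have /and3P[hij hjk hk] := chk _ hl.
rewrite clifford2_interior_X3 // !mulmxDl mulNmx -!scalemxAl -!mulmxA !rules.
rewrite !scalerDr !scalerA -scaleNr; congr (_ *: _ + _ *: _ + _ *: _); ring.
Qed.

(** Entry i is the sum, over the lines through the point i + 1, of the
    coefficient of the line times its sign in lines4. *)
Definition line_sums (al be ga de mu nu et : R) : seq R :=
  [:: al + be + mu; de - ga + mu; al + de + nu; be - ga + nu;
      al - ga - et; be + de - et; mu + nu - et].

Lemma form_psi4 al be ga de mu nu et (u : 'rV[R]_7) :
  clifford2 (interior u (form_of al be ga de mu nu et)) *m psi R 4 =
  - \sum_(i < 7) u 0 i *:
      ((line_sums al be ga de mu nu et)`_i *: (e R i.+1 *m psi R 4)).
Proof.
rewrite clifford2_interior_form !mulmxDl -!scalemxAl.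
rewrite (@line_interior_psi4 1%N 3%N 5%N 1 u isT).
rewrite (@line_interior_psi4 1%N 4%N 6%N 1 u isT).
rewrite (@line_interior_psi4 2%N 4%N 5%N (-1) u isT).
rewrite (@line_interior_psi4 2%N 3%N 6%N 1 u isT).
rewrite (@line_interior_psi4 1%N 2%N 7%N 1 u isT).
rewrite (@line_interior_psi4 3%N 4%N 7%N 1 u isT).
rewrite (@line_interior_psi4 5%N 6%N 7%N (-1) u isT).
have crdE (i : 'I_7) : u 0 i = crd u i.+1 by rewrite /crd inord_val.
under eq_bigr => i _ do rewrite crdE.
rewrite (sum7 (fun i => crd u i.+1 *:
  ((line_sums al be ga de mu nu et)`_i *: (e R i.+1 *m psi R 4)))) /=.
do 7 move: (e R _ *m psi R 4) => ?.
by apply/colP => a; rewrite !mxE; ring.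
Qed.

(** All 21 products e i *m (e j *m psi 4) with i < j, as rewriting rules: two
    points lie on exactly one line. *)
Definition psi4_rules :=
  (@lines4_rules 1%N 3%N 5%N 1 isT, @lines4_rules 1%N 4%N 6%N 1 isT,
   @lines4_rules 2%N 4%N 5%N (-1) isT, @lines4_rules 2%N 3%N 6%N 1 isT,
   @lines4_rules 1%N 2%N 7%N 1 isT, @lines4_rules 3%N 4%N 7%N 1 isT,
   @lines4_rules 5%N 6%N 7%N (-1) isT).

Definition nabla_coefs (s y : R) : seq R :=
  [:: 1 / (2 * s) - (1 - y / 2); 1 / (2 * s) + (1 - y / 2);
      y / (4 * s); y / (4 * s); y / (4 * s); y / (4 * s);
      2 * s - (1 + y) / (2 * s)].

(** In the lift of the connection along X_i, the three bivectors complete i to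
    the three lines through it, so each of them sends psi 4 to plus or minus
    X_i psi 4. *)
Lemma nabla_Xv_psi4 (s y : R) (i : 'I_7) : 0 < s -> 0 < y ->
  nabla s y (Xv R i.+1) (psi R 4)
  = - (nabla_coefs s y)`_i *: (e R i.+1 *m psi R 4).
Proof.
move=> s0 y0; have s0' : s != 0 by rewrite gt_eqF.
have [[h1 h2 h3 h4] [h5 h6 h7]] := Lambda_lift_table s0 y0.
(* With a variable in place of e, distributing products does not expand each
   e i into its four elementary summands. *)
move: psi4_rules h1 h2 h3 h4 h5 h6 h7.
move: (e R) => E rules h1 h2 h3 h4 h5 h6 h7.
rewrite /nabla; case: i => [[|[|[|[|[|[|[|//]]]]]]] _] /=.
all: rewrite ?h1 ?h2 ?h3 ?h4 ?h5 ?h6 ?h7.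
(* The indices in the table of the lift are numerals of the ring scope, of type
   nat; they are folded to plain natural numbers. *)
all: rewrite /= -?[1%R : nat]/1%N -?[2%R : nat]/2%N -?[3%R : nat]/3%N.
all: rewrite -?[4%R : nat]/4%N -?[5%R : nat]/5%N -?[6%R : nat]/6%N.
all: rewrite -?[7%R : nat]/7%N.
all: rewrite !(mulmxDl, mulNmx, =^~ scalemxAl) -!mulmxA !rules.
all: move: (E _ *m psi R 4) => x; apply/colP => a; rewrite !mxE; field.
all: by rewrite s0'.
Qed.

(** Both terms at X are sums over i of multiples of X_i psi 4, so it is enough
    to compare their factors at each basis vector X_i. *)
Lemma killing_psi4P (s y al be ga de mu nu et : R) : 0 < s -> 0 < y ->
  let T := form_of al be ga de mu nu et in
  (forall X, nabla s y X (psi R 4) + clifford2 (interior X T) *m psi R 4 = 0)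
  <-> forall i : 'I_7,
        (line_sums al be ga de mu nu et)`_i = - (nabla_coefs s y)`_i.
Proof.
move=> s0 y0 T; set l := line_sums _ _ _ _ _ _ _; set n := nabla_coefs s y.
have defect X : nabla s y X (psi R 4) + clifford2 (interior X T) *m psi R 4
    = - \sum_(i < 7) X 0 i *: ((n`_i + l`_i) *: (e R i.+1 *m psi R 4)).
  rewrite nabla_sum form_psi4 -!sumrN -big_split; apply: eq_bigr => i _ /=.
  by rewrite nabla_Xv_psi4 // scaleNr scalerN -opprD -scalerDr -scalerDl.
split=> [H i|H X]; last first.
  rewrite defect big1 ?oppr0 // => i _.
  by rewrite H addrN scale0r scaler0.
have := H (Xv R i.+1); rewrite defect (bigD1 i) //= big1 => [|j ji].
  rewrite addr0 mxE eqxx scale1r => /eqP; rewrite oppr_eq0 scaler_eq0.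
  have /negbTE -> := e_psi_neq0 (Ordinal (isT : (3 < 8)%N)) (ltn_ord i : 0 < i.+1 < 8)%N.
  by rewrite orbF addr_eq0 => /eqP ->; rewrite opprK.
by rewrite mxE eqSS -[_ == _ :> nat]/(j == i) (negbTE ji) scale0r.
Qed.

(** Let r_i be the sum over the lines through i.  The total of all r_i is three
    times the total S of all signed coefficients, and on a line l with signed
    coefficient t the r_i add up to 3 t + (S - t), since every other line meets
    l in one point; so the r_i determine S and then every t. *)
Lemma line_sums_inj (al be ga de mu nu et al' be' ga' de' mu' nu' et' : R) :
  line_sums al be ga de mu nu et = line_sums al' be' ga' de' mu' nu' et' ->
  (al, be, ga, de, mu, nu, et) = (al', be', ga', de', mu', nu', et').
Proof. by case=> *; do ![congr pair]; lra. Qed.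

Lemma T4E (s y : R) :
  let a := 1 / 2 - y / 4 - (1 + y) / (6 * s) + s / 3 in
  let b := 1 / 2 - y / 4 + (1 + y) / (6 * s) - s / 3 in
  let c := (4 + y) / (12 * s) - 2 * s / 3 in
  T4 s y = form_of a a b (- b) ((2 * y - 1) / (6 * s) - 2 * s / 3) c (- c).
Proof.
move=> a b c; apply/funext => u; apply/funext => v; apply/funext => w.
by rewrite /T4 /form_of -/a -/b -/c; ring.
Qed.

End Lines.

(** * Existence and uniqueness of the torsion form *)

Theorem proposition8p2 (R : realType) (s y : R) (hs : 0 < s) (hy : 0 < y) :
  unique
    (fun T : form3 R =>
       algebraic_form T /\
       forall X : 'rV[R]_7,
         nabla s y X (psi R 4) + clifford2 (interior X T) *m psi R 4 = 0)
    (T4 s y).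
Proof.
have s0 : s != 0 by rewrite gt_eqF.
have solves (al be ga de mu nu et : R) :
    line_sums al be ga de mu nu et = [seq - x | x <- nabla_coefs s y] <->
    forall X, nabla s y X (psi R 4) + clifford2
      (interior X (form_of al be ga de mu nu et)) *m psi R 4 = 0.
  rewrite killing_psi4P //; split=> [-> i|H]; first by rewrite (nth_map 0).
  apply: (@eq_from_nth _ 0) => // i hi; rewrite (nth_map 0) //.
  exact: (H (Ordinal (hi : (i < 7)%N))).
rewrite T4E; set a := (1 / 2 - y / 4 - _ + _); set b := (1 / 2 - y / 4 + _ - _).
set c := (4 + y) / _ - _; set m := (2 * y - 1) / _ - _.
have T4_solves :
    line_sums a a b (- b) m c (- c) = [seq - x | x <- nabla_coefs s y].
  by rewrite /a /b /c /m; do ![congr cons]; field.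
split.
  split; first by exists a, a, b, (- b), m, c, (- c).
  exact/solves.
move=> _ [[al [be [ga [de [mu [nu [et ->]]]]]]] /solves T_solves].
have := line_sums_inj (etrans T4_solves (esym T_solves)).
by case=> -> -> -> -> -> -> ->.
Qed.
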